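(* For every integer $k \ge 3$, \[ C(\textsc{mpj}_k) ~=~ O\left( n \left(\frac{k\log\log n}{\log n}\right)^{(k-2)/(k-1)} \right). \] In particular, $C(\textsc{mpj}_3) = O\left(n\sqrt{\log\log n/\log n}\right)$.
   Context: All logarithms are base $2$; $[n]=\{1,\dots,n\}$. The Boolean pointer jumping problem $\textsc{mpj}_k$ (for $k\ge 2$) is the function $\textsc{mpj}_k:[n]\times([n]^{[n]})^{k-2}\times\{0,1\}^n\to\{0,1\}$ given by $\textsc{mpj}_k(i,f_2,\ldots,f_{k-1},x) = x_{f_{k-1}\circ\cdots\circ f_2(i)}$, where $x_r$ denotes the $r$th bit of $x$ (for $k=2$ this is $x_i$). It is viewed as a $k$-player number-on-the-forehead (NOF) communication problem: the $j$th component of the input ($i$ for $j=1$, $f_j$ for $2\le j\le k-1$, $x$ for $j=k$) is written on the forehead of player $j$, who sees every component except her own. In a (deterministic, one-way) protocol, the players each write exactly one message on a public blackboard in the fixed order player $1$, player $2$, \dots, player $k$; each player's message is a deterministic function of the input components she sees and the messages already on the blackboard, and player $k$'s message must equal the value of the function. The cost of a protocol is the total number of bits written, on a worst-case input, and $C(\textsc{mpj}_k)$ is the minimum cost of such a protocol for $\textsc{mpj}_k$. *)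

(* Defs.v *)
From HB Require Import structures.
From mathcomp Require Import all_boot all_order all_algebra.
From mathcomp Require Import zify.
From mathcomp Require Import boolp reals exp.

Set Implicit Arguments.
Unset Strict Implicit.
Unset Printing Implicit Defensive.

Import Order.TTheory GRing.Theory Num.Theory.

(* Indices are shifted to start at 0: [n] is 'I_n, player j is the ordinal
   j - 1, and the function f_j is stored at index j - 2. *)
Definition mpj_input (k n : nat) : predArgType :=
  ('I_n * {ffun 'I_(k - 2) -> {ffun 'I_n -> 'I_n}} * {ffun 'I_n -> bool})%type.

Definition mpj_start k n (u : mpj_input k n) : 'I_n := u.1.1.
Definition mpj_funs k n (u : mpj_input k n) :
  {ffun 'I_(k - 2) -> {ffun 'I_n -> 'I_n}} := u.1.2.
Definition mpj_bits k n (u : mpj_input k n) : {ffun 'I_n -> bool} := u.2.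

(* The list codom (mpj_funs u) is f_2, ..., f_(k-1), and f_2 is applied
   first. *)
Definition mpj k n (u : mpj_input k n) : bool :=
  mpj_bits u
    (foldl (fun r (f : {ffun 'I_n -> 'I_n}) => f r)
       (mpj_start u) (codom (mpj_funs u))).

(* u and v agree on every component except possibly the one on the forehead
   of player j. *)
Definition same_view k n (j : 'I_k) (u v : mpj_input k n) : Prop :=
  [/\ j != 0%N :> nat -> mpj_start u = mpj_start v,
      forall l : 'I_(k - 2), j != l.+1 :> nat -> mpj_funs u l = mpj_funs v l
    & j != k.-1 :> nat -> mpj_bits u = mpj_bits v].

(* pr_msg j u b is the message written by player j on input u when the
   messages already on the blackboard are b, in the order of writing. *)
Record protocol (k n : nat) := Protocol {
  pr_msg : 'I_k -> mpj_input k n -> seq (seq bool) -> seq bool;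
  pr_msg_view : forall j u v b,
    same_view j u v -> pr_msg j u b = pr_msg j v b }.

Definition blackboard k n (P : protocol k n) (u : mpj_input k n) :
    seq (seq bool) :=
  foldl (fun b j => rcons b (pr_msg P j u b)) [::] (enum 'I_k).

Definition computes_mpj k n (P : protocol k n) : Prop :=
  forall u, last [::] (blackboard P u) = [:: mpj u].

Definition cost k n (P : protocol k n) : nat :=
  \max_(u : mpj_input k n) size (flatten (blackboard P u)).

Definition mpj_achievable k n (c : nat) : bool :=
  `[< exists P : protocol k n, computes_mpj P /\ cost P = c >].

(* The default value 0 is never used when 2 <= k: see mpj_complexityP. *)
Definition mpj_complexity (k n : nat) : nat :=
  if pselect (exists c, mpj_achievable k n c) is left ex
  then ex_minn ex else 0.

(* Player 1 writes the whole string x, and only player k speaks again. *)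
Section TrivialProtocol.
Variables k n : nat.

Definition trivial_msg (j : 'I_k) (u : mpj_input k n) (b : seq (seq bool)) :
    seq bool :=
  if j == 0%N :> nat then [seq mpj_bits u r | r <- enum 'I_n]
  else if j == k.-1 :> nat then
    [:: mpj ((mpj_start u, mpj_funs u,
              [ffun r : 'I_n => nth false (head [::] b) r]) : mpj_input k n)]
  else [::].

Lemma trivial_msg_view (k_gt1 : 1 < k) j u v b :
  same_view j u v -> trivial_msg j u b = trivial_msg j v b.
Proof.
case=> eqi eqf eqx; rewrite /trivial_msg.
case: eqP => [j0|/eqP j0].
  by rewrite eqx // j0; lia.
case: eqP => // jk; congr [:: mpj (_, _, _)]; first exact: eqi.
by apply/ffunP => l; apply: eqf; have := ltn_ord l; lia.
Qed.

Lemma trivial_protocol_computes (k_gt1 : 1 < k) :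
  computes_mpj (Protocol (trivial_msg_view k_gt1)).
Proof.
move=> u; rewrite /blackboard /=.
have foldS (s : seq 'I_k) b : b != [::] ->
    head [::] (foldl (fun b j => rcons b (trivial_msg j u b)) b s) =
    head [::] b.
  elim: s b => //= j s IHs b b0; rewrite IHs; first by case: b b0.
  by case: b b0.
have size_k := size_enum_ord k.
case def_e: (enum 'I_k) => [|j0 e]; first by rewrite def_e /= in size_k; lia.
have e0 : e != [::].
  by apply/eqP => e0; rewrite def_e e0 /= in size_k; lia.
have hj0 : j0 = 0%N :> nat.
  have := nth_enum_ord j0 (ltnW k_gt1); by rewrite def_e.
case/lastP: e e0 def_e => // e j1 _ def_e.
have hj1 : j1 = k.-1 :> nat.
  have kp : k.-1 < k by lia.
  have := nth_enum_ord j0 kp.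
  have -> : k.-1 = (size e).+1.
    by move: size_k; rewrite def_e /= size_rcons; lia.
  by rewrite def_e /= nth_rcons ltnn eqxx.
rewrite /= foldl_rcons last_rcons {1}/trivial_msg hj1 eqxx.
have -> : (k.-1 == 0%N) = false by lia.
rewrite foldS //= /trivial_msg hj0 /=; congr [:: mpj _].
case: u {foldS} => [[i f] x]; congr (_, _, _); apply/ffunP => r; rewrite ffunE.
by rewrite (nth_map r) ?size_enum_ord // nth_ord_enum.
Qed.

End TrivialProtocol.

Lemma mpj_complexityP k n : 2 <= k ->
  (exists P : protocol k n, computes_mpj P /\ cost P = mpj_complexity k n) /\
  (forall P : protocol k n, computes_mpj P -> mpj_complexity k n <= cost P).
Proof.
move=> k_gt1; rewrite /mpj_complexity; case: pselect => [ex|[]]; last first.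
  exists (cost (Protocol (@trivial_msg_view k n k_gt1))); apply/asboolP.
  by eexists; split; first exact: trivial_protocol_computes.
case: ex_minnP => c /asboolP Pc c_min; split=> // P compP.
by apply: c_min; apply/asboolP; exists P.
Qed.

Local Open Scope ring_scope.

Definition log2 (R : realType) (x : R) : R := ln x / ln 2.

(* Main.v *)
Require Import Defs.
From mathcomp Require Import all_boot all_order all_algebra.
From mathcomp Require Import zify lra.
From mathcomp Require Import reals exp.
Import Order.TTheory GRing.Theory Num.Theory.

Set Implicit Arguments.
Unset Strict Implicit.
Unset Printing Implicit Defensive.

(** Three players suffice, at cost O(n loglog n / log n) for every k >= 3.
Write the value as y (f i), where f = f_2 and y is x composed with
f_(k-1), ..., f_3.  Fix sets N i of size at most n / log n.  Player 2, who
knows i and y, writes y on N i.  Call a set T a clique for f if f j is in N i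
for all distinct i, j in T.  Player 1, who knows f and y, writes the parity of
y on f(T) for a family of cliques T; player k, who knows i and f, recovers
y (f i) from the parity of a clique containing i, since player 2 revealed y on
the rest of f(T).

A family N obtained from a random colouring of [n] x [n] with log n colours
satisfies, for every f: if f is injective on each of two disjoint sets A, B of
size r = O(log^3 n), then some pair in A x B is a clique.  So in any S on which
f is injective, all but r points outside a given A of size r have a neighbour
in A, hence some point of A has about |S| / r neighbours in S; iterating, S
contains a clique of size t = Omega(log n / loglog n) as soon as
|S| >= (2 r)^t, which is O(n / log n).  Player 1 peels off such cliques from
transversals of f until the remaining points have fewer than (2 r)^t images,
and then writes y on these images: about n / t + (2 r)^t bits in all. *)

(** * Counting colourings that miss prescribed pairs *)

Local Open Scope nat_scope.

(* Overwriting a bad colouring at the [2 #|E|] tested points with an arbitrary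
   pattern, while remembering the overwritten pattern, is injective. *)
Lemma card_avoid_pairs (X E : finType) (Q : nat) (u v : E -> X)
    (c : E -> 'I_Q * 'I_Q) :
  injective u -> injective v -> (forall e e', u e != v e') ->
  #|[set h : {ffun X -> 'I_Q} | [forall e, (h (u e), h (v e)) != c e]]|
    * (Q * Q) ^ #|E| <= (Q * Q).-1 ^ #|E| * #|{ffun X -> 'I_Q}|.
Proof.
move=> inj_u inj_v uv; set bad := [set h | _].
pose restr (h : {ffun X -> 'I_Q}) : {ffun E -> 'I_Q * 'I_Q} :=
  [ffun e => (h (u e), h (v e))].
pose over (h : {ffun X -> 'I_Q}) (g : {ffun E -> 'I_Q * 'I_Q}) :
    {ffun X -> 'I_Q} :=
  [ffun x => if [pick e | u e == x] is Some e then (g e).1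
             else if [pick e | v e == x] is Some e then (g e).2 else h x].
have over_u h g e : over h g (u e) = (g e).1.
  rewrite ffunE; case: pickP => [e' /eqP /inj_u -> //|/(_ e)].
  by rewrite eqxx.
have over_v h g e : over h g (v e) = (g e).2.
  rewrite ffunE; case: pickP => [e'|_]; first by rewrite (negPf (uv _ _)).
  case: pickP => [e' /eqP /inj_v -> //|/(_ e)]; by rewrite eqxx.
pose G := [set g : {ffun E -> 'I_Q * 'I_Q} |
            g \in family (fun e => predC1 (c e))].
have cardG : #|G| = (Q * Q).-1 ^ #|E|.
  rewrite cardsE card_family foldrE big_map.
  rewrite big_enum /= (eq_bigr (fun=> (Q * Q).-1)) ?prod_nat_const // => e _.
  by have := cardC1 (c e); rewrite card_prod card_ord => <-.
have <- : #|[set: {ffun E -> 'I_Q * 'I_Q}]| = (Q * Q) ^ #|E|.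
  by rewrite cardsT card_ffun card_prod card_ord.
rewrite -cardG -[#|{ffun X -> 'I_Q}|]cardsT -!cardsX.
pose code (hg : {ffun X -> 'I_Q} * {ffun E -> 'I_Q * 'I_Q}) :=
  (restr hg.1, over hg.1 hg.2).
have inj_code : injective code.
  move=> [h g] [h' g'] [/ffunP eqr /ffunP eqo].
  have eqg : g = g'.
    apply/ffunP => e; move: (eqo (u e)) (eqo (v e)).
    by rewrite !over_u !over_v; case: (g e) (g' e) => [a b] [a' b'] /= -> ->.
  congr (_, _) => //; apply/ffunP => x; have := eqo x; rewrite !ffunE.
  case: pickP => [e /eqP <- _|_]; first by have := eqr e; rewrite !ffunE => -[].
  by case: pickP => [e /eqP <- _|_ //]; have := eqr e; rewrite !ffunE => -[].
rewrite -(card_imset _ inj_code); apply/subset_leq_card/subsetP => z.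
case/imsetP => -[h g] /setXP[]; rewrite !inE => /forallP hbad _ ->.
rewrite andbT; apply/familyP => e; rewrite ffunE; exact: hbad.
Qed.

(** Bernoulli's inequality [(1 + 1/M)^j >= 1 + j/M] with denominators cleared. *)
Lemma expn_bernoulli M j : M ^ j * (M + j) <= M * M.+1 ^ j.
Proof.
elim: j => [|j IHj]; first by rewrite addn0 mulnC.
rewrite !expnS; have := leq_mul (leqnn M.+1) IHj.
by set A := M ^ j; set B := M.+1 ^ j; nia.
Qed.

(** Bernoulli at exponent [N]: independent tests of success probability [1/N], repeated [N] times,
    all fail with probability at most 1/2. *)
Lemma double_expn_pred N : 1 < N -> 2 * N.-1 ^ N <= N ^ N.
Proof.
case: N => // M M_gt0 /=; have := expn_bernoulli M M.+1.
rewrite -(leq_pmul2l M_gt0); set A := M ^ _; nia.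
Qed.

(** * Sparse hole-free families by the union bound *)

Lemma card_bigcup_le (I T : finType) (P : pred I) (F : I -> {set T}) :
  #|\bigcup_(i | P i) F i| <= \sum_(i | P i) #|F i|.
Proof.
apply: (big_ind2 (fun (A : {set T}) m => #|A| <= m)) => //.
  by rewrite cards0.
move=> A a B b leA leB.
exact: leq_trans (leq_card_setU A B).1 (leq_add leA leB).
Qed.

Lemma inj_ord_set (T : finType) (A : {set T}) r : r <= #|A| ->
  exists2 e : 'I_r -> T, injective e & forall x, e x \in A.
Proof.
move=> le_rA; exists (fun x => enum_val (widen_ord le_rA x)) => [x y|x].
  by move/enum_val_inj/(congr1 val) => /= /ord_inj.
exact: enum_valP.
Qed.

(** [N] is fixed before [f] because player 2, who reveals [y] on [N i], does not see [f]. A hole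
    would be a pair of large sets with no edge between them, where [i] and [j] are joined when [f j]
    is in [N i] and [f i] is in [N j]. *)
Definition hole_free n (r : nat) (N : 'I_n -> {set 'I_n}) : Prop :=
  forall (f : 'I_n -> 'I_n) (A B : {set 'I_n}),
    {in A &, injective f} -> {in B &, injective f} -> [disjoint A & B] ->
    r <= #|A| -> r <= #|B| ->
    exists i j, [/\ i \in A, j \in B, f j \in N i & f i \in N j].

Lemma exists_rare_color (T : finType) Q (h : T -> 'I_Q) : 0 < Q ->
  exists c, Q * #|[set x | h x == c]| <= #|T|.
Proof.
move=> Q_gt0; case: (boolP [exists c, Q * #|[set x | h x == c]| <= #|T|]).
  by move/existsP.
rewrite negb_exists => /forallP many.
have: \sum_(c : 'I_Q) #|T|.+1 <= \sum_(c : 'I_Q) Q * #|[set x | h x == c]|.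
  by apply: leq_sum => c _; rewrite ltnNge many.
rewrite sum_nat_const card_ord -big_distrr /= leq_pmul2l //.
have -> : \sum_(c < Q) #|[set x | h x == c]| = #|T|.
  rewrite -sum1_card (partition_big h predT) //=; apply: eq_bigr => c _.
  by rewrite -sum1_card; apply: eq_bigl => x; rewrite inE.
by rewrite ltnn.
Qed.

(** [N i] is a rare colour class in row [i] of a colouring of the cells [(i, b)]. A hole makes
    [r * r] tests on disjoint pairs of cells all fail, a fraction [(1 - 1/Q^2)^(r * r)] of the
    colourings; the hypothesis lets a union bound over all configurations succeed. *)
Lemma exists_sparse_hole_free n r Q : 0 < Q ->
  ((n * n * Q) ^ r) ^ 2 * (Q * Q).-1 ^ (r * r) < (Q * Q) ^ (r * r) ->
  exists2 N : 'I_n -> {set 'I_n}, forall i, Q * #|N i| <= n & hole_free r N.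
Proof.
move=> Q_gt0 small.
pose H := {ffun 'I_n * 'I_n -> 'I_Q}.
(* One side of a hole: [r] points, their images, and a guess of their rare colours. The colours are
   guessed because the rare colour depends on [h]. *)
pose K := {ffun 'I_r -> 'I_n * 'I_n * 'I_Q}.
(* Exactly what keeps the tested cells distinct: points and images do not repeat within a side, and
   the rows of the two sides are disjoint. *)
pose proper (k : K * K) := [&&
  [forall x, forall y, ((k.1 x).1.1 == (k.1 y).1.1) ==> (x == y)],
  [forall x, forall y, ((k.1 x).1.2 == (k.1 y).1.2) ==> (x == y)],
  [forall x, forall y, ((k.2 x).1.1 == (k.2 y).1.1) ==> (x == y)],
  [forall x, forall y, ((k.2 x).1.2 == (k.2 y).1.2) ==> (x == y)] &
  [forall x, forall y, (k.1 x).1.1 != (k.2 y).1.1]].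
pose u (k : K * K) (e : 'I_r * 'I_r) := ((k.1 e.1).1.1, (k.2 e.2).1.2).
pose v (k : K * K) (e : 'I_r * 'I_r) := ((k.2 e.2).1.1, (k.1 e.1).1.2).
pose c (k : K * K) (e : 'I_r * 'I_r) := ((k.1 e.1).2, (k.2 e.2).2).
pose bad (k : K * K) :=
  [set h : H | [forall e, (h (u k e), h (v k e)) != c k e]].
have cardK : #|{: K * K}| = ((n * n * Q) ^ r) ^ 2.
  by rewrite card_prod card_ffun !card_prod !card_ord.
have card_bad k : proper k ->
    #|bad k| * (Q * Q) ^ (r * r) <= (Q * Q).-1 ^ (r * r) * #|H|.
  case/and5P=> /'forall_forallP i1 /'forall_forallP i2 /'forall_forallP i3
    /'forall_forallP i4 /'forall_forallP i5.
  have := @card_avoid_pairs _ _ Q (u k) (v k) (c k).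
  rewrite card_prod card_ord; apply.
  - move=> [x y] [x' y'] [/eqP e1 /eqP e2]; congr (_, _); apply/eqP.
      by apply: (implyP (i1 _ _)).
    by apply: (implyP (i4 _ _)).
  - move=> [x y] [x' y'] [/eqP e1 /eqP e2]; congr (_, _); apply/eqP.
      by apply: (implyP (i2 _ _)).
    by apply: (implyP (i3 _ _)).
  - by move=> e e'; apply/eqP => -[/eqP e1 _]; move: (i5 e.1 e'.2); rewrite e1.
have H_gt0 : 0 < #|H| by rewrite card_ffun expn_gt0 card_ord Q_gt0.
have [h hgood] : exists h : H, forall k, proper k -> h \notin bad k.
  case: (boolP [exists h : H, [forall k, proper k ==> (h \notin bad k)]]).
    by case/existsP=> h /'forall_implyP; exists h.
  rewrite negb_exists => /forallP allbad.
  have cov : [set: H] \subset \bigcup_(k | proper k) bad k.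
    apply/subsetP => h _; move: (allbad h).
    rewrite negb_forall => /existsP[k]; rewrite negb_imply negbK.
    case/andP=> pk hk.
    by apply/bigcupP; exists k.
  have le1 : #|H| <= \sum_(k | proper k) #|bad k|.
    rewrite -cardsT.
    exact: leq_trans (subset_leq_card cov) (card_bigcup_le _ _).
  have: #|H| * (Q * Q) ^ (r * r) <=
        ((n * n * Q) ^ r) ^ 2 * ((Q * Q).-1 ^ (r * r) * #|H|).
    apply: leq_trans (leq_mul le1 (leqnn _)) _.
    rewrite big_distrl /= -cardK.
    apply: (leq_trans (n := \sum_(k | proper k) (Q * Q).-1 ^ (r * r) * #|H|)).
      exact: leq_sum card_bad.
    by rewrite sum_nat_const leq_mul2r max_card orbT.
  by rewrite mulnA mulnC leq_pmul2r // leqNgt small.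
have [col colP] : exists col : 'I_n -> 'I_Q, forall i,
    Q * #|[set b | h (i, b) == col i]| <= n.
  apply: (@fin_all_exists _ _ (fun i c => Q * #|[set b | h (i, b) == c]| <= n)).
  move=> i; have [a] := @exists_rare_color _ _ (fun b => h (i, b)) Q_gt0.
  by rewrite card_ord; exists a.
exists (fun i => [set b | h (i, b) == col i]) => // f A B injA injB dAB.
move=> /inj_ord_set[eA inj_eA eA_in] /inj_ord_set[eB inj_eB eB_in].
pose k : K * K := ([ffun x => (eA x, f (eA x), col (eA x))],
                   [ffun x => (eB x, f (eB x), col (eB x))]).
have pk : proper k.
  apply/and5P; split; apply/'forall_forallP => x y; rewrite !ffunE /=.
  - by apply/implyP => /eqP/inj_eA/eqP.
  - by apply/implyP => /eqP/injA e; apply/eqP/inj_eA/e.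
  - by apply/implyP => /eqP/inj_eB/eqP.
  - by apply/implyP => /eqP/injB e; apply/eqP/inj_eB/e.
  - apply/eqP => e; have := disjointFr dAB (eA_in x).
    by rewrite e eB_in.
have := hgood _ pk; rewrite inE negb_forall => /existsP[[x y]].
rewrite negbK /u /v /c !ffunE /= => /eqP[e1 e2].
by exists (eA x), (eB y); split; rewrite // inE ?e1 ?e2.
Qed.

(** * Cliques in hole-free families *)

Definition clique n (N : 'I_n -> {set 'I_n}) (f : 'I_n -> 'I_n)
    (T : {set 'I_n}) : Prop :=
  {in T &, forall i j, i != j -> f j \in N i}.

Lemma hole_free_clique n r (N : 'I_n -> {set 'I_n}) (f : 'I_n -> 'I_n) :
  hole_free r N -> forall s (S : {set 'I_n}),
  {in S &, injective f} -> (2 * r) ^ s <= #|S| ->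
  exists T : {set 'I_n}, [/\ T \subset S, #|T| = s & clique N f T].
Proof.
move=> Nr; elim=> [|s IHs] S injS leS.
  by exists set0; rewrite sub0set cards0; split=> // i j; rewrite inE.
have [r0|r_gt0] := posnP r.
  (* For [r = 0] hole-freeness is contradictory: it would find a point in the empty set. *)
  pose E : {set 'I_n} := set0.
  have [i [j [iS]]] : exists i j, [/\ i \in E, j \in E, f j \in N i & f i \in N j].
    by apply: Nr; rewrite ?r0 ?disjoints_subset ?sub0set // => x y; rewrite inE.
  by rewrite inE in iS.
have pow_gt0 : 0 < (2 * r) ^ s by rewrite expn_gt0; lia.
(* If every neighbourhood below had fewer than [(2 * r) ^ s] points, then [A], [Z] and the
   neighbourhoods would cover at most [r + (r - 1) + r * ((2 * r) ^ s - 1)] points, one of the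
   bounds this inequality contradicts. *)
have leS' : r * (2 * r) ^ s + r <= #|S|.
  by move: leS; rewrite expnS; set m := _ ^ s in pow_gt0 *; nia.
have [|e inj_e eS] := @inj_ord_set _ S r; first by nia.
pose A := [set e x | x : 'I_r].
have cardA : #|A| = r by rewrite card_imset // card_ord.
have sAS : A \subset S by apply/subsetP => _ /imsetP[x _ ->].
pose nb i := [set j in S :\: A | (f j \in N i) && (f i \in N j)].
pose Z := [set j in S :\: A | [forall i in A, j \notin nb i]].
have ltZ : #|Z| < r.
  rewrite ltnNge; apply/negP => leZ.
  have [|||||i [j [iA jZ fj fi]]] := Nr f A Z; rewrite ?cardA //.
  - by move=> x y xA yA; apply: injS; apply: (subsetP sAS).
  - by move=> x y /setIdP[/setDP[xS _] _] /setIdP[/setDP[yS _] _]; apply: injS.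
  - rewrite disjoints_subset; apply/subsetP => x xA.
    by rewrite !inE xA.
  move: jZ; rewrite inE => /andP[jSA /'forall_implyP/(_ _ iA)].
  by rewrite inE jSA fj fi.
have [i [iA le_nb]] : exists i, i \in A /\ (2 * r) ^ s <= #|nb i|.
  case: (boolP [exists i in A, (2 * r) ^ s <= #|nb i|]).
    by case/exists_inP=> i; exists i.
  rewrite negb_exists_in => /forall_inP small.
  have cov : S \subset A :|: Z :|: \bigcup_(i in A) nb i.
    apply/subsetP => j jS; rewrite !in_setU.
    have [//|jA] := boolP (j \in A).
    have jSA : j \in S :\: A by rewrite inE jA.
    have [//|] := boolP (j \in Z).
    rewrite inE jSA negb_forall_in => /exists_inP[i iA]; rewrite negbK => jnb.
    by apply/bigcupP; exists i.
  have le_cup : #|\bigcup_(i in A) nb i| <= \sum_(i in A) ((2 * r) ^ s).-1.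
    apply: (leq_trans (card_bigcup_le _ _)); apply: leq_sum => i iA.
    by have := small i iA; rewrite -ltnNge; lia.
  have := subset_leq_card cov.
  have := (leq_card_setU (A :|: Z) (\bigcup_(i in A) nb i)).1.
  have := (leq_card_setU A Z).1.
  move: le_cup; rewrite sum_nat_const cardA.
  set m := (2 * r) ^ s in pow_gt0 leS' *; move: #|_ :|: \bigcup_(_ in _) _| => x.
  move: #|\bigcup_(_ in _) _| #|A :|: Z| => y z; nia.
have [|T [sTnb cardT cliT]] := IHs (nb i) _ le_nb.
  move=> x y /setIdP[/setDP[xS _] _] /setIdP[/setDP[yS _] _]; exact: injS.
have iT : i \notin T.
  by apply: contraL iA => /(subsetP sTnb)/setIdP[/setDP[]].
exists (i |: T); split.
- rewrite subUset sub1set (subsetP sAS) //; apply: subset_trans sTnb _.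
  by apply/subsetP => j /setIdP[/setDP[]].
- by rewrite cardsU1 iT cardT.
move=> x y /setU1P[->|xT] /setU1P[->|yT]; rewrite ?eqxx //.
- by have /setIdP[_ /andP[]] := subsetP sTnb _ yT.
- by have /setIdP[_ /andP[]] := subsetP sTnb _ xT.
- exact: cliT.
Qed.

(** * Parity codes obtained by peeling cliques *)

Lemma exists_transversal (aT rT : finType) (f : aT -> rT) (R : {set aT}) :
  exists S : {set aT},
    [/\ S \subset R, {in S &, injective f} & #|f @: R| <= #|S|].
Proof.
(* [rep x] depends only on [f x], so the points that are their own representative meet each fibre in
   [R] exactly once. *)
pose rep x := [pick x' in R | f x' == f x].
exists [set x in R | rep x == Some x]; split.
- by apply/subsetP => x /setIdP[].
- move=> x y /setIdP[_ /eqP repx] /setIdP[_ /eqP repy] eqf.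
  apply: Some_inj; rewrite -repx -repy /rep eqf //.
rewrite -(card_in_imset (f := f)); last first.
  move=> x y /setIdP[_ /eqP repx] /setIdP[_ /eqP repy] eqf.
  by apply: Some_inj; rewrite -repx -repy /rep eqf.
apply/subset_leq_card/subsetP => _ /imsetP[x xR ->].
case repx: (rep x) => [y|]; last first.
  move: repx; rewrite /rep; case: pickP => // /(_ x).
  by rewrite xR eqxx.
have [yR fy] : y \in R /\ f y = f x.
  by move: repx; rewrite /rep; case: pickP => // z /andP[zR /eqP fz] [<-].
apply/imsetP; exists y => //; rewrite inE yR /=; apply/eqP.
by rewrite -repx /rep fy.
Qed.

(* [parity_code N f us]: from the parities of [y] over the sets in [us] and the
   restriction of [y] to [N i] one can read off [y (f i)]. *)
Definition parity_code n (N : 'I_n -> {set 'I_n}) (f : 'I_n -> 'I_n)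
    (us : seq {set 'I_n}) (i : 'I_n) : bool :=
  has (fun U : {set 'I_n} => (f i \in U) && (U :\ f i \subset N i)) us.

(** Strong induction on the set [R] still to be served: a clique removes [t] points for one parity,
    which [t * size us] accounts for without division. *)
Lemma exists_parity_code n r t (N : 'I_n -> {set 'I_n}) (f : 'I_n -> 'I_n) :
  hole_free r N -> 0 < t ->
  exists us, t * size us <= n + t * (2 * r) ^ t /\
    forall i, parity_code N f us i.
Proof.
move=> Nr t_gt0; set m := (2 * r) ^ t.
suff code (R : {set 'I_n}) : exists us, t * size us <= #|R| + t * m /\
    {in R, forall i, parity_code N f us i}.
  have [us []] := code setT; rewrite cardsT card_ord => le_us all_us.
  by exists us; split=> // i; apply: all_us.
have [p] := ubnP #|R|; elim: p R => // p IHp R; rewrite ltnS => le_p.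
have [S [sSR injS le_S]] := exists_transversal f R.
have [lt_m|le_m] := ltnP #|f @: R| m.
  (* Singletons transmit [y] itself on the fewer than [m] remaining images. *)
  exists [seq [set b] | b <- enum (f @: R)]; split.
    by rewrite size_map -cardE; nia.
  move=> i iR; apply/hasP; exists [set f i].
    by apply: map_f; rewrite mem_enum imset_f.
  by rewrite set11 setDv sub0set.
have [T [sTS cardT cliT]] := hole_free_clique Nr injS (leq_trans le_m le_S).
have sTR := subset_trans sTS sSR.
have cardRT : #|R :\: T| + t = #|R|.
  by have := cardsID T R; rewrite (setIidPr sTR) cardT addnC.
have [|us [le_us all_us]] := IHp (R :\: T); first by lia.
exists ((f @: T) :: us); split; first by rewrite /= mulnS -cardRT; lia.
move=> i iR; rewrite /parity_code /=; apply/orP.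
have [iT|iT] := boolP (i \in T); [left|by right; apply: all_us; rewrite inE iT].
rewrite imset_f //=; apply/subsetP => b /setD1P[neq /imsetP[j jT fj]].
rewrite fj in neq *; apply: cliT => //.
by apply: contraNneq neq => ->.
Qed.

(** * The protocol with three speakers *)

Section ThreeSpeakers.
Variables (k n a b : nat).
Variables (enc1 : {ffun 'I_n -> 'I_n} -> ('I_n -> bool) -> seq bool).
Variables (enc2 : 'I_n -> ('I_n -> bool) -> seq bool).
Variables (dec : 'I_n -> {ffun 'I_n -> 'I_n} -> seq bool -> seq bool -> bool).

Local Notation input := (mpj_input k.+3 n).

Definition first_fun (u : input) : {ffun 'I_n -> 'I_n} :=
  mpj_funs u (ord0 : 'I_k.+1).

(** It involves neither the start nor [first_fun], so players 1 and 2 can both evaluate it. *)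
Definition tail_bit (u : input) (r : 'I_n) : bool :=
  mpj_bits u (foldl (fun r (f : {ffun 'I_n -> 'I_n}) => f r) r
    [seq mpj_funs u (lift (ord0 : 'I_k.+1) l) | l <- enum 'I_k]).

Lemma mpj_first_tail u : mpj u = tail_bit u (first_fun u (mpj_start u)).
Proof.
rewrite /mpj /tail_bit codomE; congr (mpj_bits u _).
have -> : enum 'I_(k.+3 - 2) = enum 'I_k.+1 by [].
by rewrite enum_ordSl /= -map_comp.
Qed.

(** The [k] players in between write empty messages, which cost nothing. *)
Definition three_msg (j : 'I_k.+3) (u : input) (bb : seq (seq bool)) :
    seq bool :=
  if j == 0 :> nat then enc1 (first_fun u) (tail_bit u)
  else if j == 1 :> nat then enc2 (mpj_start u) (tail_bit u)
  else if j == k.+2 :> nat then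
    [:: dec (mpj_start u) (first_fun u) (nth [::] bb 0) (nth [::] bb 1)]
  else [::].

Lemma three_msg_view j u v bb :
  same_view j u v -> three_msg j u bb = three_msg j v bb.
Proof.
case=> eqi eqf eqx; rewrite /three_msg /first_fun.
have eq_tail : j != k.+2 :> nat -> j <= 1 -> tail_bit u = tail_bit v.
  move=> jk j1; rewrite /tail_bit eqx //; apply: boolp.funext => r.
  congr (mpj_bits v (foldl _ _ _)); apply: eq_map => l; apply: eqf.
  by rewrite /= /bump; lia.
case: eqP => [j0|/eqP j0].
  by rewrite eq_tail ?j0 // eqf // j0.
case: eqP => [j1|/eqP j1]; first by rewrite eq_tail ?j1 // eqi // j1.
by case: eqP => // jk; rewrite eqi ?jk // eqf // jk.
Qed.

Lemma three_blackboard u :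
  let i := mpj_start u in let f := first_fun u in let y := tail_bit u in
  let m1 := enc1 f y in let m2 := enc2 i y in
  blackboard (Protocol three_msg_view) u =
    m1 :: m2 :: rcons (nseq k [::]) [:: dec i f m1 m2].
Proof.
rewrite /blackboard /= enum_ordSl enum_ordSl enum_ordSr /=.
rewrite !map_rcons foldl_rcons -!map_comp.
have skip (s : seq 'I_k) (g : 'I_k -> 'I_k.+3) bb :
    (forall l, 1 < g l < k.+2) ->
    foldl (fun b j => rcons b (three_msg j u b)) bb (map g s) =
    bb ++ nseq (size s) [::].
  move=> g_mid; elim: s bb => [|l s IHs] bb; first by rewrite cats0.
  rewrite /= IHs /three_msg; have := g_mid l.
  do 3!(case: eqP => [->|_]; first by rewrite ?ltnn ?andbF).
  by rewrite cat_rcons.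
rewrite skip => [|l]; last by rewrite /= /bump /=; have := ltn_ord l; lia.
rewrite -enumT size_enum_ord.
rewrite /three_msg /= /bump /=.
by rewrite !add1n eqxx.
Qed.

Lemma three_speakers_complexity :
  (forall f y, size (enc1 f y) <= a) -> (forall i y, size (enc2 i y) <= b) ->
  (forall i f y, dec i f (enc1 f y) (enc2 i y) = y (f i)) ->
  mpj_complexity k.+3 n <= a + b + 1.
Proof.
move=> le_a le_b decP.
have [] := @mpj_complexityP k.+3 n isT => _ /(_ (Protocol three_msg_view)) le_c.
apply: leq_trans (le_c _) _ => [u|].
  by rewrite three_blackboard /= last_rcons decP mpj_first_tail.
have flat j (z : seq bool) : flatten (rcons (nseq j [::]) z) = z.
  by elim: j => //=; rewrite cats0.
apply/bigmax_leqP => u _; rewrite three_blackboard /= !size_cat flat.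
by rewrite addnA leq_add ?leq_add.
Qed.

End ThreeSpeakers.

Lemma parity_code_complexity k n a b (N : 'I_n -> {set 'I_n}) :
  3 <= k -> (forall i, #|N i| <= b) ->
  (forall f : {ffun 'I_n -> 'I_n},
     exists us, size us <= a /\ forall i, parity_code N f us i) ->
  mpj_complexity k n <= a + b + 1.
Proof.
case: k => [|[|[|k]]] // _ leN /fin_all_exists[us usP].
pose ok i (f : {ffun 'I_n -> 'I_n}) (U : {set 'I_n}) :=
  (f i \in U) && (U :\ f i \subset N i).
pose enc1 (f : {ffun 'I_n -> 'I_n}) (y : 'I_n -> bool) :=
  [seq \big[addb/false]_(b in U) y b | U : {set _} <- us f].
pose enc2 i (y : 'I_n -> bool) := [seq y b | b <- enum (N i)].
(* The last player sees [i] and [f], hence finds the first set serving [i]. The defaults of [nth]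
   are never read, as that set minus [f i] lies in [N i]. *)
pose dec i (f : {ffun 'I_n -> 'I_n}) (m1 m2 : seq bool) :=
  let p := find (ok i f) (us f) in
  nth false m1 p (+) \big[addb/false]_(b in nth set0 (us f) p :\ f i)
    nth false m2 (index b (enum (N i))).
apply: (@three_speakers_complexity k n a b enc1 enc2 dec) => [f y|i y|i f y].
- by rewrite size_map; have [] := usP f.
- by rewrite size_map -cardE.
have [_ /(_ i) us_i] := usP f; rewrite /dec /=.
have /andP[fiU sUN] := nth_find set0 us_i.
rewrite (nth_map set0) -?has_find //.
set U := nth set0 _ _ in fiU sUN *.
(* Splitting [y (f i)] off the parity over [U] leaves two equal sums, which cancel. *)
rewrite (big_setD1 (f i)) //= -addbA.
rewrite [X in _ (+) (_ (+) X)](eq_bigr y) ?addbb ?addbF // => c cU.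
have cN : c \in enum (N i) by rewrite mem_enum (subsetP sUN).
by rewrite /enc2 (nth_map c) ?index_mem // nth_index.
Qed.

(** * Choice of parameters *)

Lemma union_bound_size n L : 1 < L -> n < 2 ^ L.+1 ->
  ((n * n * L) ^ (8 * L * (L * L))) ^ 2 *
    (L * L).-1 ^ (8 * L * (L * L) * (8 * L * (L * L))) <
  (L * L) ^ (8 * L * (L * L) * (8 * L * (L * L))).
Proof.
move=> L_gt1 lt_n; set M := L * L; set r := 8 * L * M.
have M_gt1 : 1 < M by rewrite /M; nia.
have r_gt0 : 0 < r by rewrite /r; nia.
have lt_config : n * n * L < 2 ^ (3 * L + 2).
  have -> : 3 * L + 2 = L.+1 + L.+1 + L by lia.
  by rewrite !expnD !ltn_mul // ltn_expl.
have lt_config2 : (n * n * L) ^ 2 < 2 ^ (8 * L).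
  apply: leq_trans (ltn_mul lt_config lt_config) _.
  by rewrite -expnD leq_exp2l //; lia.
(* As [r = 8 * L * M], this is [double_expn_pred] at [M] raised to the power [8 * L]. It beats the
   configuration count after [r]-th roots are taken. *)
have le_pow : 2 ^ (8 * L) * M.-1 ^ r <= M ^ r.
  rewrite /r [8 * L * M]mulnC (expnM M) (expnM M.-1) -expnMn.
  rewrite leq_exp2r; last by lia.
  exact: double_expn_pred.
rewrite -expnM [r * 2]mulnC expnM [_ ^ (r * r)]expnM [X in _ < X]expnM.
rewrite -expnMn ltn_exp2r //; apply: leq_trans le_pow.
by rewrite ltn_pmul2r // expn_gt0; lia.
Qed.

(** Gives [4 * v <= L] in the next proof; the bound first holds at [e = 7], whence the threshold
    [2 ^ 7]. *)
Lemma mul_log_bound e : 7 <= e -> 16 + 12 * e.+1 <= 2 ^ e.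
Proof.
elim: e => // e IHe; rewrite leq_eqVlt => /orP[/eqP<- //|/IHe].
rewrite expnS; lia.
Qed.

Lemma mpj_complexity_trunc_log k n :
  3 <= k -> 2 ^ 7 <= trunc_log 2 n ->
  trunc_log 2 n * mpj_complexity k n <=
    32 * (trunc_log 2 (trunc_log 2 n)).+1 * n.
Proof.
set L := trunc_log 2 n => k_ge3 L_ge.
have L_gt0 : 0 < L by apply: leq_trans L_ge.
(* [v] is chosen so that [2 * r = 16 * L^3] is at most [2 ^ v]. *)
set e := trunc_log 2 L; set v := 4 + 3 * e.+1.
have [le_eL lt_Le] : 2 ^ e <= L /\ L < 2 ^ e.+1.
  by split; [apply: trunc_logP | apply: trunc_log_ltn].
have e_ge7 : 7 <= e by apply: trunc_log_max.
have le_vL : 4 * v <= L.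
  by apply: leq_trans le_eL; apply: leq_trans (mul_log_bound e_ge7); lia.
have n_gt0 : 0 < n.
  by rewrite lt0n; apply/eqP => n0; rewrite /L n0 trunc_log0 in L_gt0.
have le_Ln : 2 ^ L <= n by apply: trunc_logP.
pose r := 8 * L * (L * L).
have [N leN Nr] : exists2 N : 'I_n -> {set 'I_n},
    forall i, L * #|N i| <= n & hole_free r N.
  apply: exists_sparse_hole_free => //; apply: union_bound_size; first by lia.
  exact: trunc_log_ltn.
(* Then [m <= 2 ^ (v * t) <= 2 ^ (L / 2)], which leaves room for the factor [L] in [L * m <= n]. *)
pose t := L %/ (2 * v).
have t_gt0 : 0 < t by rewrite divn_gt0; lia.
have le_tL : t * (2 * v) <= L by apply: leq_trunc_div.
have lt_Lt : L < t.+1 * (2 * v) by apply: ltn_ceil; lia.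
pose m := (2 * r) ^ t.
have le_Lm : L * m <= n.
  have le_2r : 2 * r <= 2 ^ v.
    have -> : v = 4 + (e.+1 + e.+1 + e.+1) by rewrite /v; lia.
    have := leq_mul (leq_mul (ltnW lt_Le) (ltnW lt_Le)) (ltnW lt_Le).
    by rewrite !expnD /r; move: (2 ^ e.+1) => W; lia.
  have le_m : m <= (2 ^ v) ^ t by rewrite leq_exp2r.
  apply: leq_trans (leq_mul (ltnW lt_Le) le_m) _.
  rewrite -expnM -expnD; apply: leq_trans le_Ln; rewrite leq_exp2l //; nia.
pose a := n %/ t + m; pose b := n %/ L.
have le_c : mpj_complexity k n <= a + b + 1.
  apply: (@parity_code_complexity _ _ _ _ N) => // [i|f].
    by rewrite leq_divRL // mulnC.
  have [us [le_us us_all]] := exists_parity_code f Nr t_gt0.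
  exists us; split=> //; rewrite /a addnC -leq_subLR leq_divRL //.
  by rewrite mulnBl leq_subLR mulnC [m * t]mulnC addnC.
(* Since [t >= 1], rounding in [t] loses at most a factor 2: [L < (t + 1) * 2 * v <= 4 * v * t]. *)
have le_La : L * (n %/ t) <= 4 * v * n.
  have : n %/ t * t <= n by apply: leq_trunc_div.
  move: (n %/ t) => x; nia.
have le_Lb : L * b <= n by rewrite mulnC leq_trunc_div.
have le_L1 : L <= n by apply: leq_trans le_Ln; apply/ltnW/ltn_expl.
apply: leq_trans (leq_mul (leqnn L) le_c) _; rewrite /a !mulnDr.
suff : 4 * v + 3 <= 32 * e.+1 by nia.
by lia.
Qed.

(** * Passing to real logarithms *)

Local Open Scope ring_scope.

Lemma ln2_gt0 (R : realType) : 0 < ln (2 : R).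
Proof. by rewrite ln_gt0 // ltr1n. Qed.

Lemma ler_log2 (R : realType) (x y : R) : 0 < x -> x <= y -> log2 x <= log2 y.
Proof.
move=> x_gt0 le_xy; rewrite ler_pM2r ?invr_gt0 ?ln2_gt0 // ler_ln //.
by rewrite posrE (lt_le_trans x_gt0).
Qed.

Lemma log2_expn (R : realType) (j : nat) : log2 (2 ^ j)%N%:R = j%:R :> R.
Proof.
rewrite /log2 natrX lnXn ?ltr0n // -[ln _ *+ _]mulr_natl mulfK //.
by rewrite gt_eqF // ln2_gt0.
Qed.

Lemma trunc_log_le_log2 (R : realType) (n : nat) : (0 < n)%N ->
  (trunc_log 2 n)%:R <= log2 (n%:R : R).
Proof.
move=> n_gt0; rewrite -[leLHS](log2_expn R) ler_log2 ?ltr0n ?expn_gt0 //.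
by rewrite ler_nat trunc_logP.
Qed.

Lemma log2_le_trunc_logS (R : realType) (n : nat) : (0 < n)%N ->
  log2 (n%:R : R) <= (trunc_log 2 n).+1%:R.
Proof.
move=> n_gt0; rewrite -[leRHS](log2_expn R) ler_log2 ?ltr0n //.
by rewrite ler_nat ltnW // trunc_log_ltn.
Qed.

(** The linear bound serves where the base of the final power exceeds 1. The threshold [n0] is
    uniform in [k]. *)
Lemma mpj_complexity_loglog (R : realType) : exists n0 : nat,
  forall k n : nat, (3 <= k)%N -> (n0 <= n)%N ->
    let l : R := log2 (log2 n%:R) / log2 n%:R in
    [/\ 0 < l, (mpj_complexity k n)%:R <= 128 * (n%:R * l)
      & (mpj_complexity k n)%:R <= 128 * n%:R :> R].
Proof.
have [n0 n0P] : exists n0, forall n, (n0 <= n -> 2 ^ 7 <= trunc_log 2 n)%N.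
  by exists (2 ^ (2 ^ 7))%N => n le_n; apply: trunc_log_max.
exists n0 => k n k_ge3 /n0P L_ge l.
have := mpj_complexity_trunc_log k_ge3 L_ge.
set L := trunc_log 2 n in L_ge *; set e := trunc_log 2 L.
set c := mpj_complexity k n => le_c.
have L_gt0 : (0 < L)%N by apply: leq_trans L_ge.
have e_gt0 : (0 < e)%N by apply: (@leq_trans 7) => //; apply: trunc_log_max.
have n_gt0 : (0 < n)%N.
  by rewrite lt0n; apply/eqP => n0'; rewrite /L n0' trunc_log0 in L_gt0.
have le_eL : (e.+1 <= L)%N.
  by apply: leq_trans (trunc_logP (isT : 1 < 2)%N L_gt0); exact: ltn_expl.
have leLR := trunc_log_le_log2 R n_gt0.
have logn_gt0 : 0 < log2 n%:R :> R by apply: lt_le_trans leLR; rewrite ltr0n.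
have logLR := log2_le_trunc_logS R n_gt0.
have lell : e%:R <= log2 (log2 n%:R) :> R.
  apply: le_trans (trunc_log_le_log2 R L_gt0) _.
  by rewrite ler_log2 // ltr0n.
have e_gt0R : 0 < e%:R :> R by rewrite ltr0n.
split.
- by rewrite divr_gt0 // (lt_le_trans e_gt0R).
- rewrite /l mulrA mulrA ler_pdivlMr //.
  (* 128 is 32 times 2 for [e + 1 <= 2 * e], times 2 for [log2 n <= L + 1 <= 2 * L]. *)
  have le_ce : (c * (2 * L) <= 128 * n * e)%N by nia.
  apply: (@le_trans _ _ (c * (2 * L))%N%:R).
    rewrite natrM ler_wpM2l //; apply: le_trans logLR _.
    by rewrite ler_nat; lia.
  apply: (@le_trans _ _ (128 * n * e)%N%:R); first by rewrite ler_nat.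
  by rewrite natrM natrM ler_wpM2l // mulr_ge0.
have le_c32 : (c <= 128 * n)%N.
  by rewrite -(leq_pmul2l L_gt0); apply: leq_trans le_c _; nia.
by rewrite -natrM ler_nat.
Qed.

Theorem theorem1p3 (R : realType) :
  (exists (c : R) (n0 : nat), 0 < c /\
     forall k n : nat, (3 <= k)%N -> (n0 <= n)%N ->
       (mpj_complexity k n)%:R <=
         c * (n%:R * (k%:R * log2 (log2 n%:R) / log2 n%:R)
                       `^ ((k%:R - 2) / (k%:R - 1))))
  /\
  (exists (c : R) (n0 : nat), 0 < c /\
     forall n : nat, (n0 <= n)%N ->
       (mpj_complexity 3 n)%:R <=
         c * (n%:R * Num.sqrt (log2 (log2 n%:R) / log2 n%:R))).
Proof.
have [n0 n0P] := mpj_complexity_loglog R.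
split; exists 128, n0; split=> //; last move=> n le_n.
  move=> k n k_ge3 le_n.
  have [] := n0P k n k_ge3 le_n; rewrite -mulrA.
  set l := _ / _ => l_gt0 le_l le_1.
  have k_ge3R : 3 <= k%:R :> R by rewrite ler_nat.
  have [exp_ge0 exp_le1] : 0 <= (k%:R - 2) / (k%:R - 1) :> R /\
      (k%:R - 2) / (k%:R - 1) <= 1 :> R.
    split; first by apply: divr_ge0; lra.
    by rewrite ler_pdivrMr; lra.
  have le_lkl : l <= k%:R * l by rewrite ler_peMl; lra.
  (* A base in (0, 1] only grows under an exponent in [0, 1]; for a base above 1 the power is at
     least 1 and the linear bound suffices. *)
  have [kl_le1|kl_gt1] := lerP (k%:R * l) 1.
    apply: le_trans le_l _; rewrite ler_wpM2l // ler_wpM2l //.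
    apply: (le_trans le_lkl); apply: ger1_powR => //.
    by rewrite kl_le1 (lt_le_trans l_gt0 le_lkl).
  apply: le_trans le_1 _; rewrite ler_wpM2l // ler_peMr //.
  by rewrite -[leLHS](powRr0 (k%:R * l)) ler_powR // ltW.
have [] := n0P 3 n isT le_n; set l := _ / _ => l_gt0 le_l le_1.
have sqrt_ge0 := sqrtr_ge0 l.
have sqr_sqrt := sqr_sqrtr (ltW l_gt0).
have [l_le1|l_gt1] := lerP (Num.sqrt l) 1.
  apply: le_trans le_l _; rewrite ler_wpM2l // ler_wpM2l //; nra.
by apply: le_trans le_1 _; rewrite ler_wpM2l // ler_peMr // ltW.
Qed.
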